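(* Let $d$ be a positive integer and let $F:\mathbb{R}^d\to\mathbb{R}$ be a continuous function which is nondegenerate and noncompact. Let $x\in X_d$ be a lattice whose $H_F$-orbit is nondivergent (i.e. not divergent), let $U<\mathbb{R}^d$ be a subspace rational with respect to $x$, let $w\in\mathbb{R}^d$, and let $\lambda_{w+U}$ be the translation by $w$ of the Haar probability measure supported on the subtorus $U+x$. If there exists a divergent sequence $h_n\in H_F$ such that $h_nx$ converges in $X_d$ and $h_n$ is not almost finite with respect to $U$, then $x$ is $\lambda_{w+U}$-almost surely grid-DV, i.e. $\lambda_{w+U}$-almost every grid $y\in\pi^{-1}(x)$ is DV.
   Context: Let $G=\mathrm{SL}_d(\mathbb{R})$, $\Gamma=\mathrm{SL}_d(\mathbb{Z})$. $X_d=G/\Gamma$ (quotient topology) is identified with the space of unimodular (covolume 1) lattices in $\mathbb{R}^d$ via $g\Gamma\mapsto g\mathbb{Z}^d$. $Y_d=(G\ltimes\mathbb{R}^d)/(\Gamma\ltimes\mathbb{Z}^d)$ (quotient topology) is identified with the space of unimodular grids, i.e. translated lattices $x+v=\{w+v:w\in x\}$ with $x\in X_d$, $v\in\mathbb{R}^d$. $\pi:Y_d\to X_d$ is $\pi(x+v)=x$; the fiber $\pi^{-1}(x)$ is identified with the torus $\mathbb{R}^d/x$. $G$ acts on $X_d$ and $Y_d$ by the linear action on subsets of $\mathbb{R}^d$. For a continuous $F:\mathbb{R}^d\to\mathbb{R}$ and $y\in Y_d$, the value set is $V_F(y)=\{F(v):v\in y\}$. A grid $y$ is DV (dense values) if $V_F(y)$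 is dense in $F(\mathbb{R}^d)$. For a probability measure $\mu$ on $\pi^{-1}(x)$, the lattice $x$ is $\mu$-almost surely grid-DV if $\mu$-almost every $y\in\pi^{-1}(x)$ is DV. A subspace $U<\mathbb{R}^d$ is rational with respect to $x\in X_d$ if $x\cap U$ is a lattice in $U$; then $U+x$ denotes the corresponding closed connected subgroup (subtorus) of $\pi^{-1}(x)\cong\mathbb{R}^d/x$, $\lambda_U$ its Haar probability measure, and for $w\in\mathbb{R}^d$, $\lambda_{w+U}$ is the translate of $\lambda_U$ by $w$, supported on the coset $w+(U+x)$. The invariance group $H_F$ is the connected component of the identity in $\{g\in G:F\circ g=F\}$. $F$ is noncompact if $H_F$ is noncompact. $F$ is nondegenerate if for every subspace $\{0\}\ne U<\mathbb{R}^d$ and every grid $y\in Y_d$ one has $\{F(u+v):u\in U,\ v\in y\}=F(\mathbb{R}^d)$. A sequence in a topological space is divergent if it has no converging subsequence. An orbit $H_Fx$ is divergent if for every divergent sequence $h_n\in H_F$ the sequence $h_nx$ is divergent in $X_d$. A sequence $h_n\in G$ is almost finite with respect to a subspace $U<\mathbb{R}^d$ if there exists a sequence $\epsilon_n\in G$ with $\epsilon_n\to e$ (the identity) such that the set of restrictions $\{\epsilon_nh_n|_U\}$ is finite. *)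

(* Defs.v *)
From HB Require Import structures.
From mathcomp Require Import all_boot all_order all_algebra.
From mathcomp Require Import generic_quotient.
From mathcomp Require Import all_classical all_reals all_analysis.

Set Implicit Arguments.
Unset Strict Implicit.
Unset Printing Implicit Defensive.

Import Order.TTheory GRing.Theory Num.Theory.
Import numFieldNormedType.Exports.

Local Open Scope classical_set_scope.
Local Open Scope quotient_scope.
Local Open Scope ring_scope.

Section SpecialLinearGroup.
Variables (A : comUnitRingType) (d : nat).

Record SL := MkSL { SLval :> 'M[A]_d ; _ : \det SLval == 1 }.

HB.instance Definition _ := [isSub for SLval].
HB.instance Definition _ := [Choice of SL by <:].

Lemma det_SL (g : SL) : \det (g : 'M[A]_d) = 1.
Proof. by apply/eqP; case: g. Qed.

Lemma SL_unitmx (g : SL) : (g : 'M[A]_d) \in unitmx.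
Proof. by rewrite unitmxE det_SL unitr1. Qed.

Fact SLone_subproof : \det (1%:M : 'M[A]_d) == 1.
Proof. by rewrite det1. Qed.

Fact SLmul_subproof (g h : SL) : \det ((g : 'M[A]_d) *m h) == 1.
Proof. by rewrite det_mulmx !det_SL mulr1. Qed.

Fact SLinv_subproof (g : SL) : \det (invmx (g : 'M[A]_d)) == 1.
Proof. by rewrite det_inv det_SL invr1. Qed.

Definition SLone : SL := MkSL SLone_subproof.
Definition SLmul (g h : SL) : SL := MkSL (SLmul_subproof g h).
Definition SLinv (g : SL) : SL := MkSL (SLinv_subproof g).

Fact SLmulA : associative SLmul.
Proof. by move=> f g h; apply/val_inj; rewrite /= mulmxA. Qed.
Fact SLmul1 : left_id SLone SLmul.
Proof. by move=> g; apply/val_inj; rewrite /= mul1mx. Qed.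
Fact SLmulr1 : right_id SLone SLmul.
Proof. by move=> g; apply/val_inj; rewrite /= mulmx1. Qed.
Fact SLmulV : left_inverse SLone SLinv SLmul.
Proof. by move=> g; apply/val_inj; rewrite /= mulVmx ?SL_unitmx. Qed.
Fact SLmulrV : right_inverse SLone SLinv SLmul.
Proof. by move=> g; apply/val_inj; rewrite /= mulmxV ?SL_unitmx. Qed.

HB.instance Definition _ :=
  isGroup.Build SL SLmulA SLmul1 SLmulr1 SLmulV SLmulrV.

End SpecialLinearGroup.

HB.instance Definition _ (R : realType) (d : nat) :=
  Topological.copy (SL R d)
    (initial_topology ((fun g => g) : SL R d -> 'M[R]_d)).

Section SpaceOfLattices.
Variables (R : realType) (d : nat).

Fact SLZ_subproof (g : SL int d) : \det (map_mx intr g : 'M[R]_d) == 1.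
Proof. by rewrite det_map_mx det_SL rmorph1. Qed.

Definition SLZ_SLR (g : SL int d) : SL R d := MkSL (SLZ_subproof g).

Lemma SLZ_SLR1 : SLZ_SLR 1%g = 1%g.
Proof. by apply/val_inj; rewrite /= map_mx1. Qed.

Lemma SLZ_SLRM g h : SLZ_SLR (g * h)%g = (SLZ_SLR g * SLZ_SLR h)%g.
Proof. by apply/val_inj; rewrite /= map_mxM. Qed.

Definition SLZ_rel (g h : SL R d) : bool :=
  `[< exists gamma : SL int d, h = (g * SLZ_SLR gamma)%g >].

Fact SLZ_rel_refl : reflexive SLZ_rel.
Proof. by move=> g; apply/asboolP; exists 1%g; rewrite SLZ_SLR1 mulg1. Qed.

Fact SLZ_rel_sym : symmetric SLZ_rel.
Proof.
suff H g h : SLZ_rel g h -> SLZ_rel h g by move=> g h; apply/idP/idP; exact: H.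
move=> /asboolP[c ->]; apply/asboolP; exists (c^-1)%g.
by rewrite -mulgA -SLZ_SLRM mulgV SLZ_SLR1 mulg1.
Qed.

Fact SLZ_rel_trans : transitive SLZ_rel.
Proof.
move=> h g k /asboolP[a ->] /asboolP[b ->]; apply/asboolP; exists (a * b)%g.
by rewrite SLZ_SLRM mulgA.
Qed.

Canonical SLZ_equiv := EquivRel SLZ_rel SLZ_rel_refl SLZ_rel_sym SLZ_rel_trans.

Definition Xd : Type := quotient_topology {eq_quot SLZ_equiv}.

HB.instance Definition _ := Topological.on Xd.
HB.instance Definition _ := Quotient.on Xd.

(* The class of g stands for the lattice g Z^d; see lattice_pi. *)
Definition lattice (x : Xd) : set 'cV[R]_d :=
  [set (repr x : 'M[R]_d) *m map_mx intr z | z in [set: 'cV[int]_d]].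

Definition SLact (g : SL R d) (x : Xd) : Xd := \pi_Xd (g * repr x)%g.

Lemma Xd_eqP (g h : SL R d) : \pi_Xd g = \pi_Xd h <-> SLZ_rel g h.
Proof. by split=> [/eqmodP|H]; last exact/eqmodP. Qed.

Lemma lattice_pi (g : SL R d) : lattice (\pi_Xd g) =
  [set (g : 'M[R]_d) *m map_mx intr z | z in [set: 'cV[int]_d]].
Proof.
have : SLZ_rel g (repr (\pi_Xd g)) by apply/Xd_eqP; rewrite reprK.
move=> /asboolP[c cE]; rewrite /lattice cE; apply/seteqP; split => _ [z _ <-].
  by exists ((c : 'M[int]_d) *m z) => //=; rewrite map_mxM mulmxA.
exists (((c^-1)%g : SL int d) *m z) => //=.
by rewrite -mulmxA -map_mxM mulmxA mulmxV ?SL_unitmx// mul1mx.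
Qed.

Lemma SLact_pi (g h : SL R d) : SLact g (\pi_Xd h) = \pi_Xd (g * h)%g.
Proof.
have : SLZ_rel h (repr (\pi_Xd h)) by apply/Xd_eqP; rewrite reprK.
move=> /asboolP[c cE]; apply/esym/Xd_eqP/asboolP; exists c.
by rewrite cE mulgA.
Qed.

Lemma lattice_SLact (g : SL R d) (x : Xd) :
  lattice (SLact g x) = [set (g : 'M[R]_d) *m p | p in lattice x].
Proof.
rewrite lattice_pi /lattice; apply/seteqP; split => [_ [z _ <-]|_ [_ [z _ <-]] <-].
  by exists ((repr x : 'M[R]_d) *m map_mx intr z); [exists z|rewrite mulmxA].
by exists z => //=; rewrite mulmxA.
Qed.

Definition grid (x : Xd) (v : 'cV[R]_d) : set 'cV[R]_d :=
  [set p + v | p in lattice x].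

Definition Yd : set (set 'cV[R]_d) :=
  [set y | exists x v, y = grid x v].

(* the fiber of the projection Yd -> Xd over x *)
Definition fiber (x : Xd) : set (set 'cV[R]_d) := range (grid x).

End SpaceOfLattices.

Section Torus.
Variables (R : realType) (d : nat) (x : Xd R d).

Definition torus_rel (v w : 'cV[R]_d) : bool := `[< lattice x (v - w) >].

Lemma lattice0 : lattice x 0.
Proof. by exists 0 => //; rewrite map_mx0 mulmx0. Qed.

Lemma latticeN p : lattice x p -> lattice x (- p).
Proof. by move=> [z _ <-]; exists (- z) => //; rewrite map_mxN mulmxN. Qed.

Lemma latticeD p q : lattice x p -> lattice x q -> lattice x (p + q).
Proof.
by move=> [y _ <-] [z _ <-]; exists (y + z) => //; rewrite map_mxD mulmxDr.
Qed.

Fact torus_rel_refl : reflexive torus_rel.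
Proof. by move=> v; apply/asboolP; rewrite subrr; exact: lattice0. Qed.

Fact torus_rel_sym : symmetric torus_rel.
Proof.
by move=> v w; apply/idP/idP => /asboolP/latticeN H; apply/asboolP;
  rewrite -opprB.
Qed.

Fact torus_rel_trans : transitive torus_rel.
Proof.
move=> v u w /asboolP uv /asboolP vw; apply/asboolP.
by rewrite -(subrKA v); exact: latticeD.
Qed.

Canonical torus_equiv :=
  EquivRel torus_rel torus_rel_refl torus_rel_sym torus_rel_trans.

Definition torus : Type := quotient_topology {eq_quot torus_equiv}.

HB.instance Definition _ := Topological.on torus.
HB.instance Definition _ := Pointed.on torus.
HB.instance Definition _ := Quotient.on torus.

Definition borel_torus : Type := g_sigma_algebraType (@open torus).

HB.instance Definition _ := Measurable.on borel_torus.

Lemma torus_eqP (v w : 'cV[R]_d) :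
  \pi_torus v = \pi_torus w <-> lattice x (v - w).
Proof. by split=> [/eqmodP/asboolP|H]; last exact/eqmodP/asboolP. Qed.

(* The identification of the torus with the fiber over x; see torus_grid_bij. *)
Definition torus_grid (t : torus) : set 'cV[R]_d := grid x (repr t).

Lemma torus_grid_pi v : torus_grid (\pi_torus v) = grid x v.
Proof.
have : lattice x (v - repr (\pi_torus v)) by apply/torus_eqP; rewrite reprK.
move=> vL; apply/seteqP; split => _ [p px <-].
  exists (p - (v - repr (\pi_torus v))).
    exact/latticeD/latticeN.
  by rewrite opprB addrA subrK.
exists (p + (v - repr (\pi_torus v))); first exact: latticeD.
by rewrite addrA subrK.
Qed.

Lemma torus_grid_bij : set_bij [set: torus] (fiber x) torus_grid.
Proof.
split.
- by move=> t _; exists (repr t).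
- move=> s t _ _ st.
  have : torus_grid t (repr s).
    by rewrite -st; exists 0; [exact: lattice0|rewrite add0r].
  move=> [p px pE]; rewrite -(reprK s) -(reprK t); apply/torus_eqP.
  by rewrite -pE addrK.
- by move=> _ [v _ <-]; exists (\pi_torus v) => //; rewrite torus_grid_pi.
Qed.

Definition torus_translate (w : 'cV[R]_d) (t : borel_torus) : borel_torus :=
  \pi_torus (repr (t : torus) + w).

Lemma torus_translate_pi w v :
  torus_translate w (\pi_torus v) = \pi_torus (v + w).
Proof.
apply/torus_eqP; rewrite opprD addrACA subrr addr0.
by apply/torus_eqP; rewrite reprK.
Qed.

Definition subtorus (U : {vspace 'cV[R]_d}) : set borel_torus :=
  [set \pi_torus u | u in [set` U]].

Definition lattice_in (U : {vspace 'cV[R]_d}) (L : set 'cV[R]_d) : Prop :=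
  exists b : (\dim U).-tuple 'cV[R]_d, basis_of U b /\
    L = [set \sum_(i < \dim U) (z i)%:~R *: tnth b i | z in
         [set: 'I_(\dim U) -> int]].

Definition rational_subspace (U : {vspace 'cV[R]_d}) : Prop :=
  lattice_in U (lattice x `&` [set` U]).

(* The Haar probability measure of the closed subgroup subtorus U, regarded as
   a Borel measure on the whole torus: it is carried by subtorus U, which is
   closed, hence measurable, when U is rational, and it is invariant under the
   translations by elements of U. *)
Definition is_haar_subtorus (U : {vspace 'cV[R]_d})
    (lambda : probability borel_torus R) : Prop :=
  lambda (subtorus U) = 1%E /\
  forall (u : 'cV[R]_d) (B : set borel_torus), u \in U -> measurable B ->
    lambda (torus_translate u @^-1` B) = lambda B.

End Torus.

Section GridValues.
Variables (R : realType) (d : nat) (F : 'cV[R]_d -> R).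

Definition value_set (y : set 'cV[R]_d) : set R := F @` y.

(* Density in the subspace F(R^d), of which value_set y is a subset. *)
Definition DV (y : set 'cV[R]_d) : Prop :=
  range F `<=` closure (value_set y).

Definition as_grid_DV (x : Xd R d) (mu : set (borel_torus x) -> \bar R) : Prop :=
  {ae mu, forall t, DV (torus_grid t)}.

Definition stabilizer : set (SL R d) :=
  [set g | F \o mulmx (g : 'M[R]_d) = F].

Definition invariance_group : set (SL R d) :=
  connected_component stabilizer 1%g.

Definition noncompact_fun : Prop := ~ compact invariance_group.

Definition nondegenerate_fun : Prop :=
  forall (U : {vspace 'cV[R]_d}) (y : set 'cV[R]_d), U != 0%VS -> Yd y ->
    [set F (u + v) | u in [set` U] & v in y] = range F.

End GridValues.

Definition divergent_seq (T : topologicalType) (u : nat -> T) : Prop :=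
  forall (phi : nat -> nat) (l : T),
    increasing_seq phi -> ~ (u \o phi @ \oo --> l).

Definition divergent_orbit (R : realType) (d : nat) (H : set (SL R d))
    (x : Xd R d) : Prop :=
  forall h : nat -> SL R d, (forall n, H (h n)) ->
    divergent_seq h -> divergent_seq (fun n => SLact (h n) x).

Definition almost_finite (R : realType) (d : nat) (h : nat -> SL R d)
    (U : {vspace 'cV[R]_d}) : Prop :=
  exists eps : nat -> SL R d, eps @ \oo --> (1%g : SL R d) /\
    finite_set (range (fun n (u : subvs_of U) =>
      ((eps n * h n)%g : 'M[R]_d) *m vsval u)).

(* Main.v *)
(* For an open set O meeting the values of F, let D be the set of those t in the
   torus whose grid has no value in O; it is closed, and it suffices that D is
   null.  Pick lifts g_n = h_n g gamma_n converging to some g0 and, since h_n is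
   not almost finite, a vector b in U with |h_n b| unbounded.  By nondegeneracy
   and compactness (of the fiber and of the unit sphere), there are finitely
   many scalars q_1, ..., q_r such that for n large and every unit vector e,
   every grid in the fiber over h_n x acquires a value in O after translation
   by some q_i e.  With e = h_n b / |h_n b|, pulling back by h_n, every t leaves
   D after translation by one of u_i = q_i b / |h_n b|.  Hence the measure of D
   is at most the sum over i of that of D minus (D - u_i); each term tends to 0
   as u_i -> 0, because the measure is finite and invariant under U and D is
   closed. *)

Require Import Defs.
From mathcomp Require Import all_boot all_order all_algebra.
From mathcomp Require Import generic_quotient.
From mathcomp Require Import all_classical all_reals all_analysis.
From mathcomp Require Import lra.

Import Order.TTheory GRing.Theory Num.Theory.
Import numFieldNormedType.Exports.

Local Open Scope classical_set_scope.
Local Open Scope quotient_scope.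
Local Open Scope ring_scope.

(** * Entrywise limits of matrices and the topology of [SL] *)

Section MatrixLimits.
Context {R : realType} {T : Type} (Phi : set_system T) {FPhi : Filter Phi}.

Lemma cvg_mxP {m n} (A : T -> 'M[R]_(m, n)) (L : 'M[R]_(m, n)) :
  A t @[t --> Phi] --> L <-> forall i j, A t i j @[t --> Phi] --> L i j.
Proof.
split=> [AL i j|AL P [Q LQ QP]].
  exact: (cvg_comp _ _ AL (@coord_continuous R m n i j L)).
rewrite nbhs_simpl/=; have : \forall t \near Phi, forall ij : 'I_m * 'I_n,
    Q ij.1 ij.2 (A t ij.1 ij.2).
  by apply: filter_forall => -[i j]; exact/AL/LQ.
by apply: filterS => t At; apply: QP => i j; exact: (At (i, j)).
Qed.

Lemma cvg_mulmx {m n p} (A : T -> 'M[R]_(m, n)) (B : T -> 'M[R]_(n, p))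
  (L : 'M[R]_(m, n)) (M : 'M[R]_(n, p)) :
  A t @[t --> Phi] --> L -> B t @[t --> Phi] --> M ->
  A t *m B t @[t --> Phi] --> L *m M.
Proof.
move=> /cvg_mxP AL /cvg_mxP BM; apply/cvg_mxP => i j.
under eq_fun do rewrite mxE; rewrite mxE.
by apply: (cvg_big add_continuous) => k _; apply: cvgM; [exact: AL|exact: BM].
Qed.

Lemma cvg_trmx {m n} (A : T -> 'M[R]_(m, n)) (L : 'M[R]_(m, n)) :
  A t @[t --> Phi] --> L -> (A t)^T @[t --> Phi] --> L^T.
Proof.
move=> /cvg_mxP AL; apply/cvg_mxP => i j.
by under eq_fun do rewrite mxE; rewrite mxE; exact: AL.
Qed.

Lemma cvg_det {n} (A : T -> 'M[R]_n) (L : 'M[R]_n) :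
  A t @[t --> Phi] --> L -> \det (A t) @[t --> Phi] --> \det L.
Proof.
move=> /cvg_mxP AL; apply: (cvg_big add_continuous) => s _.
apply: cvgM; first exact: cvg_cst.
by apply: (cvg_big mul_continuous) => i _; exact: AL.
Qed.

(** Determinant one turns the inverse into the adjugate, whose entries are signed minors and hence
    continuous. *)
Lemma cvg_SLinv {d} (A : T -> SL R d) (L : SL R d) :
  (A t : 'M[R]_d) @[t --> Phi] --> (L : 'M[R]_d) ->
  invmx (A t : 'M[R]_d) @[t --> Phi] --> invmx (L : 'M[R]_d).
Proof.
have invE (g : SL R d) : invmx (g : 'M[R]_d) = \adj g.
  by rewrite /invmx SL_unitmx det_SL invr1 scale1r.
move=> AL; under eq_fun do rewrite invE; rewrite invE.
apply/cvg_mxP => i j; under eq_fun do rewrite mxE; rewrite mxE.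
apply: cvgM; first exact: cvg_cst.
apply: cvg_det; apply/cvg_mxP => k l.
under eq_fun do rewrite !mxE; rewrite !mxE.
exact: (iffLR (cvg_mxP _ _) AL).
Qed.

Lemma cvg_SLP {d} (A : T -> SL R d) (L : SL R d) :
  A t @[t --> Phi] --> L <->
  (A t : 'M[R]_d) @[t --> Phi] --> (L : 'M[R]_d).
Proof.
split=> [AL|AL P].
  exact: (cvg_comp _ _ AL
    (@initial_continuous _ _ (fun g : SL R d => g : 'M[R]_d) L)).
rewrite nbhsE => -[_ [[Q oQ <-] QL QP]].
have AQ : \forall t \near Phi, Q (A t) by apply: AL; exact: open_nbhs_nbhs.
by rewrite nbhs_simpl /=; apply: filterS AQ => t; exact: QP.
Qed.

End MatrixLimits.

(** * Lifting convergence from the space of lattices to matrices *)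

Section Lifts.
Context {R : realType} {d : nat}.

Lemma SLval_continuous : continuous (fun g : SL R d => (g : 'M[R]_d)).
Proof. exact: (@initial_continuous _ _ (fun g : SL R d => g : 'M[R]_d)). Qed.

Lemma SLmulr_continuous (c : SL R d) :
  continuous (fun g : SL R d => (g * c)%g : SL R d).
Proof.
move=> g; have Fg : Filter (nbhs (g : SL R d)) by exact: nbhs_filter.
apply/(cvg_SLP (nbhs (g : SL R d)) (fun h : SL R d => (h * c)%g : SL R d)).
exact: (cvg_mulmx _ (fun h : SL R d => SLval h) (fun=> SLval c) _ _
  (@SLval_continuous g) (cvg_cst _)).
Qed.

(* [gam n] nearly minimizes the distance from the lift to [g0], so that one
   sequence serves every neighborhood of [g0]. *)
Lemma cvg_Xd_lift (a : nat -> SL R d) (g0 : SL R d) :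
  (\pi_(Xd R d) (a n)) @[n --> \oo] --> (\pi_(Xd R d) g0 : Xd R d) ->
  exists gam : nat -> SL int d,
    ((a n * SLZ_SLR R (gam n))%g : 'M[R]_d) @[n --> \oo] --> (g0 : 'M[R]_d).
Proof.
move=> ax.
pose dist n c := `|SLval g0 - SLval (a n * SLZ_SLR R c)%g|.
have near_lift e : 0 < e -> \forall n \near \oo, exists c, dist n c < e.
  move=> e0; pose V := [set h : SL R d | `|SLval g0 - SLval h| < e].
  have oV : open V.
    exists (ball (g0 : 'M[R]_d) e); first exact: ball_open.
    by apply/seteqP; split=> h /=; rewrite -ball_normE.
  pose W : set (Xd R d) := [set \pi_(Xd R d) h | h in V].
  have oW : open W.
    rewrite /open/= /quotient_open.
    (* The projection is an open map: the saturation of [V] is the union of its right translates by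
       integer matrices, each of them open. *)
    have -> : \pi_(Xd R d) @^-1` W =
        \bigcup_c [set h | V (h * SLZ_SLR R c)%g].
      apply/seteqP; split=> [h [k Vk /Xd_eqP/asboolP[c hE]]|h [c _ Vh]].
        exists c^-1%g => //=.
        by rewrite hE -mulgA -SLZ_SLRM mulgV SLZ_SLR1 mulg1.
      exists (h * SLZ_SLR R c)%g => //; apply/Xd_eqP/asboolP; exists c^-1%g.
      by rewrite -mulgA -SLZ_SLRM mulgV SLZ_SLR1 mulg1.
    apply: bigcup_open => c _.
    exact: (iffLR (continuousP _) (SLmulr_continuous _) _ oV).
  have Wx0 : W (\pi_(Xd R d) g0).
    by exists g0 => //; rewrite /V/= subrr normr0.
  have := ax _ (open_nbhs_nbhs (conj oW Wx0)).
  rewrite nbhs_simpl /=; apply: filterS => n [h Vh /esym/Xd_eqP/asboolP[c hE]].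
  by exists c; rewrite /dist -hE.
have hinf n : has_inf (range (dist n)).
  split; first by exists (dist n 1%g); exists 1%g.
  by exists 0 => _ [c _ <-]; exact: normr_ge0.
have pick n : exists c, dist n c < inf (range (dist n)) + n.+1%:R^-1.
  have [|_ [c _ <-] ?] := inf_adherent (_ : 0 < n.+1%:R^-1) (hinf n).
    by rewrite invr_gt0.
  by exists c.
have [gam gamP] := choice pick.
exists gam; apply/cvgrPdist_lt => e e0.
have e20 : 0 < e / 2 by rewrite divr_gt0.
near=> n; apply: lt_le_trans (gamP n) _; rewrite [leRHS]splitr lerD//.
  have [c ce] : exists c, dist n c < e / 2 by near: n; exact: near_lift.
  by apply/ltW/(le_lt_trans _ ce)/(ge_inf (hinf n).2); exists c.
by apply/ltW; near: n; exact: (near_infty_natSinv_lt (PosNum e20)).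
Unshelve. all: by end_near. Qed.

End Lifts.

(** * Boundedness of [h n] on [U] and almost finiteness *)

Section Boundedness.
Context {R : realType}.

Lemma ler_coord_norm {m n} (A : 'M[R]_(m, n)) i j : `|A i j| <= `|A|.
Proof.
by rewrite [leRHS]/Num.norm/= mx_normrE; exact: (le_bigmax _ _ (i, j)).
Qed.

Lemma ler_coord_mulmx {m n p} (A : 'M[R]_(m, n)) (B : 'M[R]_(n, p)) i j :
  `|(A *m B) i j| <= n%:R * (`|A| * `|B|).
Proof.
rewrite mxE (le_trans (ler_norm_sum _ _ _))//.
have -> : n%:R * (`|A| * `|B|) = \sum_(k < n) `|A| * `|B| :> R.
  by rewrite sumr_const card_ord mulr_natl.
by apply: ler_sum => k _; rewrite normrM ler_pM// ler_coord_norm.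
Qed.

Lemma finite_int_mx_bounded m n (B : nat) :
  finite_set [set A : 'M[int]_(m, n) | forall i j, `|A i j| <= B%:Z].
Proof.
(* Adding [B] moves the entries into the range from 0 to 2B, so the ordinals below [(B + B).+1]
   enumerate them. *)
apply: (@sub_finite_set _ _ ((fun A : 'M['I_(B + B).+1]_(m, n) =>
    map_mx (fun a : 'I_(B + B).+1 => (a : nat)%:Z - B%:Z) A) @` setT)).
  move=> A AB; exists (map_mx (fun a : int => inord (absz (a + B%:Z))) A) => //.
  apply/matrixP => i j; rewrite !mxE.
  have := AB i j; rewrite ler_norml => /andP[AB1 AB2].
  have AB0 : 0 <= A i j + B%:Z by rewrite -lerBlDr sub0r.
  rewrite inordK; first by rewrite gez0_abs// addrK.
  by rewrite ltnS -lez_nat gez0_abs// PoszD lerD2r.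
exact/finite_image/finite_finset.
Qed.

Context {d : nat}.

(** If z_i are the integer coordinates of the basis vector b_i, then h_n b_i = g_n gamma_n^-1 z_i,
    where g_n = h_n g gamma_n converges to g0. Boundedness of h_n b_i confines the integer vectors
    gamma_n^-1 z_i to a finite set, and eps_n = g0 g_n^-1 tends to 1 with eps_n h_n b_i = g0
    gamma_n^-1 z_i. *)
Lemma bounded_almost_finite (h : nat -> SL R d) (x x0 : Xd R d)
    (U : {vspace 'cV[R]_d}) :
  rational_subspace x U -> SLact (h n) x @[n --> \oo] --> x0 ->
  (forall b, b \in U -> exists M, forall n, `|(h n : 'M[R]_d) *m b| <= M) ->
  almost_finite h U.
Proof.
move=> [b [bU Lb]] hx bnd; set g := repr x; set g0 := repr x0.
have [gam gamP] : exists gam : nat -> SL int d,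
    ((h n * g * SLZ_SLR R (gam n))%g : 'M[R]_d) @[n --> \oo] --> (g0 : 'M[R]_d).
  by apply: cvg_Xd_lift; rewrite reprK.
pose gn n := (h n * g * SLZ_SLR R (gam n))%g : SL R d.
pose k := \dim U.
have /choice[z zE] i : exists z : 'cV[int]_d,
    (g : 'M[R]_d) *m map_mx intr z = tnth b i.
  have : (lattice x `&` [set` U]) (tnth b i).
    rewrite Lb; exists (fun j => (i == j)%:Z) => //.
    rewrite (bigD1 i)//= eqxx scale1r big1 ?addr0// => j.
    by rewrite eq_sym => /negPf->; rewrite scale0r.
  by move=> [[w _ wE] _]; exists w.
have ginv n i : invmx (gn n : 'M[R]_d) *m ((h n : 'M[R]_d) *m tnth b i) =
    map_mx intr (((gam n)^-1%g : SL int d) *m z i : 'cV_d).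
  apply: (can_inj (mulKmx (SL_unitmx (gn n)))).
  rewrite mulKVmx ?SL_unitmx//= -zE map_mxM -!mulmxA; congr (_ *m (_ *m _)).
  by rewrite mulmxA -map_mxM mulmxV ?SL_unitmx// map_mx1 mul1mx.
have icvg : invmx (gn n : 'M[R]_d) @[n --> \oo] --> invmx (g0 : 'M[R]_d).
  exact: cvg_SLinv.
have [C Cinv] : exists C, forall n, `|invmx (gn n : 'M[R]_d)| <= C.
  have : cvgn (fun n => invmx (gn n : 'M[R]_d)).
    by apply/cvg_ex; eexists; exact: icvg.
  move=> /cvg_seq_bounded[C [_ CP]]; exists (C + 1) => n.
  by apply: CP => //; rewrite ltrDl.
have /choice[M MP] i : exists M, forall n, `|(h n : 'M[R]_d) *m tnth b i| <= M.
  by apply: bnd; apply: (basis_mem bU); exact: mem_tnth.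
(* A common bound for the integer entries: the factor [d%:R] comes from [ler_coord_mulmx], and the
   successor makes up for the truncation. *)
pose B := (\sum_i Num.trunc (d%:R * (C * M i))).+1%N.
exists (fun n => g0 * (gn n)^-1)%g; split.
  apply/cvg_SLP; rewrite -[X in _ --> X](mulmxV (SL_unitmx g0)).
  exact: (cvg_mulmx _ (fun=> SLval g0) (fun n => invmx (SLval (gn n))) _ _
    (cvg_cst _) icvg).
(* [Phi] rebuilds a restriction to [U] from the integer matrix with columns gamma_n^-1 z_i, so
   finitely many matrices leave finitely many restrictions. *)
pose Phi (A : 'M[int]_(d, k)) (u : subvs_of U) : 'cV[R]_d :=
  \sum_i coord b i (vsval u) *: ((g0 : 'M[R]_d) *m map_mx intr (col i A)).
apply: sub_finite_set (finite_image Phi (finite_int_mx_bounded d k B)).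
move=> _ [n _ <-]; pose A : 'M[int]_(d, k) :=
  \matrix_(i, j) (((gam n)^-1%g : SL int d) *m z j : 'cV_d) i 0.
have colA j : col j A = ((gam n)^-1%g : SL int d) *m z j.
  by apply/matrixP => i l; rewrite (ord1 l) !mxE.
exists A.
  move=> i j; rewrite -(ler_int R) intr_norm.
  have -> : (A i j)%:~R =
      (invmx (gn n : 'M[R]_d) *m ((h n : 'M[R]_d) *m tnth b j)) i 0.
    by rewrite ginv !mxE.
  apply: (le_trans (ler_coord_mulmx _ _ _ _)).
  apply: (@le_trans _ _ (d%:R * (C * M j))).
    by rewrite ler_wpM2l// ler_pM.
  apply/ltW/(lt_le_trans (truncnS_gt _)).
  by rewrite ler_nat ltnS (bigD1 j)//= leq_addr.
apply/funext => u; rewrite /Phi [in RHS](coord_basis bU (subvsP u)) mulmx_sumr.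
apply: eq_bigr => i _; rewrite -scalemxAr colA -ginv -(tnth_nth 0).
by congr (_ *: _); rewrite /= !mulmxA.
Qed.

(** Contrapositive of [bounded_almost_finite]; a bound valid from some index on becomes global by
    adding the finitely many earlier norms. The index is found beyond any [N] so that it can also
    meet conditions that hold eventually. *)
Lemma exists_unbounded (h : nat -> SL R d) (x x0 : Xd R d)
    (U : {vspace 'cV[R]_d}) :
  rational_subspace x U -> SLact (h n) x @[n --> \oo] --> x0 ->
  ~ almost_finite h U ->
  exists2 b, b \in U &
    forall M N, exists2 n, (N <= n)%N & M < `|(h n : 'M[R]_d) *m b|.
Proof.
move=> Urat hx hU; apply: contrapT => nb; apply: hU.
apply: (@bounded_almost_finite h x x0) => // b bU.
have [M [N MN]] : exists M N, forall n, (N <= n)%N ->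
    `|(h n : 'M[R]_d) *m b| <= M.
  apply: contrapT => nMN; apply: nb; exists b => // M N.
  apply: contrapT => nn; apply: nMN; exists M, N => n Nn.
  by rewrite leNgt; apply/negP => Mn; apply: nn; exists n.
exists (`|M| + \sum_(i < N) `|(h i : 'M[R]_d) *m b|) => n.
have [Nn|nN] := leqP N n.
  by rewrite (le_trans (MN n Nn))// (le_trans (ler_norm M))// lerDl sumr_ge0.
rewrite (bigD1 (Ordinal nN))//= addrCA lerDl addr_ge0// sumr_ge0//.
Qed.

End Boundedness.

(** * Borel measure on the torus and small translations *)

Section TorusMeasure.
Context {R : realType} {d : nat} {x : Xd R d}.

Lemma open_measurable_torus (A : set (torus x)) :
  open A -> measurable (A : set (borel_torus x)).
Proof. by move=> oA; apply: sub_sigma_algebra. Qed.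

Lemma closed_measurable_torus (A : set (torus x)) :
  closed A -> measurable (A : set (borel_torus x)).
Proof.
move=> /closed_openC/open_measurable_torus mA.
by rewrite -[A]setCK; exact: measurableC.
Qed.

(** The lift to the vector space is the union of the balls of radius [e] about the points over [A].
    It serves below for closed sets [A]. *)
Lemma open_torus_thickening (A : set (torus x)) (e : R) :
  open [set t : torus x |
    exists2 u : 'cV[R]_d, `|u| < e & A (torus_translate u t)].
Proof.
rewrite /open/= /quotient_open.
have -> : \pi_(torus x) @^-1`
    [set t : torus x |
      exists2 u : 'cV[R]_d, `|u| < e & A (torus_translate u t)] =
    \bigcup_(v in \pi_(torus x) @^-1` A) ball v e.
  apply/seteqP; split=> [v [u ue]|v [p Ap]].
    rewrite torus_translate_pi => Avu; exists (v + u) => //.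
    by rewrite -ball_normE/= addrC addKr.
  rewrite -ball_normE/= => vpe; exists (p - v) => //.
  by rewrite torus_translate_pi addrC subrK.
by apply: bigcup_open => v _; exact: ball_open.
Qed.

Lemma torus_translate_near (A : set (torus x)) (t : torus x) :
  open A -> A t -> \forall u \near (0 : 'cV[R]_d), A (torus_translate u t).
Proof.
move=> oA At; have /nbhs_ballP[e e0 eA] :
    nbhs (repr t) (\pi_(torus x) @^-1` A).
  by apply: open_nbhs_nbhs; split => //=; rewrite reprK.
apply/nbhs_ballP; exists e => // u; rewrite -ball_normE/= sub0r => ue.
by apply: eA; rewrite -ball_normE/= opprD addNKr.
Qed.

Lemma measurable_torus_translate (u : 'cV[R]_d) :
  measurable_fun setT (torus_translate u : borel_torus x -> borel_torus x).
Proof.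
apply: (@measurability _ _ (borel_torus x) (borel_torus x) setT
  (torus_translate u) (@open (torus x)) erefl) => _ [A oA <-].
rewrite setTI; apply: open_measurable_torus.
rewrite /open/= /quotient_open.
have -> : \pi_(torus x) @^-1` (torus_translate u @^-1` A) =
    (fun v => v + u) @^-1` (\pi_(torus x) @^-1` A).
  by apply/seteqP; split=> v /=; rewrite torus_translate_pi.
have shift_cts : continuous (fun v : 'cV[R]_d => v + u).
  by move=> v; apply: continuousD => //; exact: cst_continuous.
exact: (iffLR (continuousP _) shift_cts _ oA).
Qed.

(** The radius is the same for all directions of [u]: it comes from continuity from above along
    shrinking thickenings of [D] with [D] removed. *)
Lemma haar_setD_translate_small (U : {vspace 'cV[R]_d})
    (lambda : probability (borel_torus x) R) (D : set (torus x)) (e : R) :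
  is_haar_subtorus U lambda -> closed D -> 0 < e ->
  exists2 r : R, 0 < r & forall u : 'cV[R]_d, u \in U -> `|u| < r ->
    (lambda (D `\` torus_translate u @^-1` D) <= e%:E)%E.
Proof.
move=> [_ inv] cD e0.
have oC : open (~` D) by exact: closed_openC.
(* By invariance [D `\` (D - u)] has the measure of [(D - u) `\` D], which lies
   in [E k] when [|u| < 1 / (k + 1)]. *)
pose E (k : nat) : set (borel_torus x) := ~` D `&`
  [set t : torus x |
    exists2 u : 'cV[R]_d, `|u| < k.+1%:R^-1 & D (torus_translate u t)].
have mD := closed_measurable_torus D cD.
have mE k : measurable (E k).
  apply: measurableI; first exact: open_measurable_torus.
  by apply: open_measurable_torus; exact: open_torus_thickening.
have E0 : \bigcap_k E k = set0.
  rewrite -subset0 => t Et.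
  (* A point off the closed set [D] stays off it under all short enough translations, so it drops
     out of [E k] for large [k]. *)
  have [/= Dt _] := Et 0%N I.
  have /nbhs_ballP[r r0 rC] := torus_translate_near _ _ oC Dt.
  have [k _ kr] := near_infty_natSinv_lt (PosNum r0).
  have [_ [u uk]] := Et k I; apply: rC.
  rewrite -ball_normE/= sub0r normrN (lt_trans uk)//.
  exact: (kr k (leqnn k)).
have : lambda \o E @ \oo --> lambda (\bigcap_k E k).
  apply: nonincreasing_cvg_mu => //.
  - by rewrite (le_lt_trans (probability_le1 _ _))// ltry.
  - by rewrite E0; exact: measurable0.
  - move=> i j ij; apply/subsetPset => t [Dt [u uj Du]]; split => //.
    exists u => //; apply: (lt_le_trans uj).
    by rewrite lef_pV2 ?posrE// ler_nat ltnS.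
rewrite E0 measure0 => /fine_cvgP[_ /cvgrPdist_lt/(_ _ e0)[k _ kE]].
exists k.+1%:R^-1 => [|u uU uk]; first by rewrite invr_gt0.
have mT : measurable (torus_translate u @^-1` D).
  by rewrite -[X in measurable X]setTI; exact: measurable_torus_translate.
have fin A : measurable A -> (lambda A < +oo)%E.
  by move=> mA; rewrite (le_lt_trans (probability_le1 _ mA))// ltry.
have -> : lambda (D `\` torus_translate u @^-1` D) =
    lambda ((torus_translate u @^-1` D : set (borel_torus x)) `\` D).
  rewrite !measureD ?fin//; congr (_ - _)%E; last by rewrite setIC.
  exact/esym/inv.
apply: (@le_trans _ _ (lambda (E k))).
  apply: le_measure; rewrite ?inE//; first exact: measurableD.
  by move=> t [Dut Dt]; split => //; exists u.
have := kE k (leqnn k); rewrite /= sub0r normrN ger0_norm; last exact: fine_ge0.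
move=> /ltW; rewrite -lee_fin fineK// ge0_fin_numE//; exact: fin.
Qed.

End TorusMeasure.

(** * Uniform hitting of an open set by translated grids *)

Section Hitting.
Context {R : realType} {d : nat} (F : 'cV[R]_d -> R) (Fcts : continuous F).

(** Compactness is taken over row vectors while grids consist of columns; this lets unit vectors
    pass between the two. *)
Lemma norm_trmx {m n} (A : 'M[R]_(m, n)) : `|A^T| = `|A|.
Proof.
have le p q (B : 'M[R]_(p, q)) : `|B^T| <= `|B|.
  rewrite [leLHS]/Num.norm/= mx_normrE bigmax_le// => -[i j] _ /=.
  by rewrite mxE ler_coord_norm.
by apply/le_anti; rewrite le -{1}[A]trmxK le.
Qed.

(** Codes of no rational fall back to 0. What matters is that every rational occurs, so that a bound
    on the index selects finitely many scalars. *)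
Definition rat_enum (i : nat) : R := ratr (odflt 0 (unpickle i)).

(** The parameter space of [uniform_hitting]: for the sup norm the ball contains the unit cube,
    hence representatives of all offsets modulo integer vectors, and the sphere carries the
    directions. *)
Lemma compact_ball_sphere : compact ([set p : 'rV[R]_d | `|p| <= 1] `*`
  [set e : 'rV[R]_d | `|e| = 1]).
Proof.
apply: compact_setX; apply: bounded_closed_compact.
- by exists 1; split=> // M M1 p /= p1; rewrite (le_trans p1)// ltW.
- apply: (@closed_comp _ _ (fun p : 'rV[R]_d => `|p|) [set r | r <= 1]).
    by move=> p _; exact: norm_continuous.
  exact: closed_le.
- by exists 1; split=> // M M1 p /= ->; rewrite ltW.
- apply: (@closed_comp _ _ (fun p : 'rV[R]_d => `|p|) [set r | r = 1]).
    by move=> p _; exact: norm_continuous.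
  exact: closed_eq.
Qed.

(** Nondegeneracy, applied to the line through [e] and the grid g0 (Z^d + p), gives a real scalar
    that reaches [O]; by openness a rational one does too, and it keeps working for all nearby p, e
    and g. Compactness then bounds its index. *)
Lemma uniform_hitting (g0 : SL R d) (O : set R) :
  nondegenerate_fun F -> open O -> (O `&` range F) !=set0 ->
  exists r : nat, \forall g \near (g0 : 'M[R]_d), forall p e : 'cV[R]_d,
    `|e| = 1 -> exists2 i, (i < r)%N & exists z : 'cV[int]_d,
      O (F (rat_enum i *: e + g *m (map_mx intr z + p))).
Proof.
move=> Fnd oO [y [Oy [q _ qy]]]; rewrite -{y}qy in Oy.
pose P (i : nat * 'M[R]_d) (pe : 'rV[R]_d * 'rV[R]_d) :=
  exists2 k, (k < i.1)%N & exists z : 'cV[int]_d,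
    O (F (rat_enum k *: pe.2^T + i.2 *m (map_mx intr z + pe.1^T))).
have /compact_near_coveringP := compact_ball_sphere.
(* The filter pairs index bounds tending to infinity with matrices near [g0], so that compactness
   yields one bound and one neighborhood together. *)
move=> /(_ _ (filter_prod \oo (nbhs (g0 : 'M[R]_d))) P _)[].
  move=> [p e] [/= _ e1].
  have eU : <[e^T]>%VS != 0%VS.
    apply/eqP => eU0; have := memv_line e^T; rewrite eU0 memv0 => /eqP e0.
    by move: e1 => /eqP; rewrite -[e]trmxK e0 trmx0 normr0 eq_sym oner_eq0.
  have : range F (F q) by exists q.
  have gY : Yd (grid (\pi_(Xd R d) g0) ((g0 : 'M[R]_d) *m p^T)).
    by do 2!eexists.
  rewrite -(Fnd _ _ eU gY).
  move=> [u /vlineP[s ->{u}] [v' [p' + <-{v'}]]].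
  rewrite lattice_pi => -[z _ <-{p'}]; set v := _ *m _ + _ => sv.
  have [k Ok] : exists k, O (F (rat_enum k *: e^T + v)).
    have : \forall s' \near s, O (F (s' *: e^T + v)).
      have cts : continuous (fun s' : R => F (s' *: e^T + v)).
        move=> s'; apply: continuous_comp; last exact: Fcts.
        apply: continuousD; last exact: cst_continuous.
        exact: scalel_continuous.
      apply: (cts s); apply: open_nbhs_nbhs; split => //=; rewrite sv.
      exact: Oy.
    move=> /nbhs_ballP[a /= a0 aO].
    have [|c] := @rat_in_itvoo R (s - a) (s + a); first by rewrite /=; lra.
    rewrite in_itv/= => /andP[c1 c2]; exists (pickle c).
    rewrite /rat_enum pickleK/=; apply: aO.
    by rewrite -ball_normE/= ltr_distlC c1 c2.
  pose Phi := filter_prod (nbhs (p, e)) (filter_prod \oo (nbhs (g0 : 'M[R]_d))).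
  have FPhi : Filter Phi by apply: filter_prod_filter.
  have pcvg : t.1.1 @[t --> Phi] --> p.
    exact: (cvg_comp _ _ cvg_fst cvg_fst).
  have ecvg : t.1.2 @[t --> Phi] --> e.
    exact: (cvg_comp _ _ cvg_fst cvg_snd).
  have gcvg : t.2.2 @[t --> Phi] --> (g0 : 'M[R]_d).
    exact: (cvg_comp _ _ cvg_snd cvg_snd).
  have icvg : t.2.1 @[t --> Phi] --> \oo.
    exact: (cvg_comp _ _ cvg_snd cvg_fst).
  have : rat_enum k *: t.1.2^T + t.2.2 *m (map_mx intr z + t.1.1^T)
      @[t --> Phi] --> rat_enum k *: e^T + v.
    rewrite /v -mulmxDr; apply: cvgD.
      exact: (cvg_comp _ _ (cvg_trmx _ _ _ ecvg)
        (@scaler_continuous _ _ (rat_enum k) e^T)).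
    apply: cvg_mulmx => //; apply: cvgD; first exact: cvg_cst.
    exact: cvg_trmx.
  move=> /(cvg_comp _ _)/(_ (Fcts _)) FO.
  have kt : \forall t \near Phi, (k < t.2.1)%N.
    by apply: (icvg [set n | (k < n)%N]); exists k.+1.
  have Ot := FO _ (open_nbhs_nbhs (conj oO Ok)).
  by apply: filterS2 kt Ot => t kt Ot; exists k => //; exists z.
move=> [A B] /= [[r _ rA] Bg0] AB; exists r.
apply: filterS Bg0 => g Bg p e e1.
(* Subtracting the floor brings the offset into the unit cube; the integer vector removed is
   absorbed in [z]. *)
pose fl : 'cV[int]_d := map_mx Num.floor p.
have [] := AB (r, g) (conj (rA r (leqnn r)) Bg) ((p - map_mx intr fl)^T, e^T).
  split => /=.
    rewrite [leLHS]/Num.norm/= mx_normrE bigmax_le// => -[i j] _ /=.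
    rewrite !mxE; have /andP[f1 f2] := floor_itv (p j i).
    rewrite ger0_norm ?subr_ge0// lerBlDl ltW//.
    by move: f2; rewrite intrD.
  by rewrite norm_trmx.
move=> i /= ir [z]; rewrite !trmxK => Oz; exists i => //; exists (z - fl).
by rewrite map_mxB addrAC -addrA.
Qed.

End Hitting.

(** * Nullity of the set of grids avoiding an open set *)

Section AvoidingGrids.
Context {R : realType} {d : nat} (F : 'cV[R]_d -> R) (Fcts : continuous F).
Context {x : Xd R d}.

(** The shift [w] is built in so that the Haar measure of [subtorus U] can be used directly, instead
    of its translate. *)
Definition avoiding (w : 'cV[R]_d) (O : set R) : set (torus x) :=
  [set t | forall p, lattice x p -> ~ O (F (p + (repr t + w)))].

(** Two representatives differ by a lattice vector, which the quantifier over [p] absorbs. *)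
Lemma avoiding_pi w O (v : 'cV[R]_d) : avoiding w O (\pi_(torus x) v) <->
  forall p, lattice x p -> ~ O (F (p + (v + w))).
Proof.
have vL : lattice x (v - repr (\pi_(torus x) v)).
  by apply/torus_eqP; rewrite reprK.
split=> avo p px.
  have := avo _ (latticeD px vL).
  by rewrite addrA -[p + _ + _]addrA subrK -addrA.
have := avo _ (latticeD px (latticeN vL)).
by rewrite opprB addrA -[p + _ + _]addrA subrK -addrA.
Qed.

Lemma avoiding_translate w O :
  torus_translate w @^-1` avoiding 0 O = avoiding w O.
Proof.
apply/seteqP; split=> t; rewrite -[t]reprK /= torus_translate_pi avoiding_pi;
  by rewrite avoiding_pi addr0.
Qed.

Lemma closed_avoiding w O : open O -> closed (avoiding w O).
Proof.
move=> oO; rewrite -[avoiding w O]setCK; apply: open_closedC.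
rewrite /open/= /quotient_open.
have -> : \pi_(torus x) @^-1` (~` avoiding w O) =
    \bigcup_(p in lattice x) [set v | O (F (p + (v + w)))].
  apply/seteqP; split=> [v /= nav|v [p px Ov] /avoiding_pi/(_ p px)//].
  apply: contrapT => nv; apply/nav/avoiding_pi => p px Ov.
  by apply: nv; exists p.
apply: bigcup_open => p _.
have cts : continuous (fun v : 'cV[R]_d => F (p + (v + w))).
  move=> v; apply: continuous_comp; last exact: Fcts.
  apply: continuousD; first exact: cst_continuous.
  by apply: continuousD => //; exact: cst_continuous.
exact: (iffLR (continuousP _) cts _ oO).
Qed.

Lemma avoiding_null (x0 : Xd R d) (U : {vspace 'cV[R]_d}) (w : 'cV[R]_d)
    (lambda : probability (borel_torus x) R) (h : nat -> SL R d) (O : set R) :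
  nondegenerate_fun F -> rational_subspace x U -> is_haar_subtorus U lambda ->
  (forall n, stabilizer F (h n)) -> SLact (h n) x @[n --> \oo] --> x0 ->
  ~ almost_finite h U ->
  open O -> (O `&` range F) !=set0 -> lambda (avoiding w O) = 0%E.
Proof.
move=> Fnd Urat haar hF hx hU oO OF.
set g := repr x; set g0 := repr x0; set D := avoiding w O.
have [gam gamP] : exists gam : nat -> SL int d,
    ((h n * g * SLZ_SLR R (gam n))%g : 'M[R]_d) @[n --> \oo] --> (g0 : 'M[R]_d).
  by apply: cvg_Xd_lift; rewrite reprK.
have [b bU b_unbd] := exists_unbounded h x x0 U Urat hx hU.
have [r Hr] := uniform_hitting F Fcts g0 O Fnd oO OF.
have [N _ HN] := gamP _ Hr.
have cD : closed D by exact: closed_avoiding.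
have mD := closed_measurable_torus D cD.
apply/eqP; rewrite eq_le measure_ge0 andbT.
apply/lee_addgt0Pr => e e0; rewrite add0e.
(* The successor keeps the denominator positive when [r] is 0; the [r] terms still add up to at most
   [e]. *)
have er0 : 0 < e / r.+1%:R by rewrite divr_gt0.
have [delta delta0 Hdelta] :=
  haar_setD_translate_small U lambda D _ haar cD er0.
(* [Q] dominates every |q_i| with i < r, so the threshold on |h_n b| in the next line forces |q_i|
   |b| / |h_n b| < [delta] for all of them. *)
pose Q := 1 + \sum_(i < r) `|rat_enum i : R|.
have [n Nn Mn] := b_unbd (Q * (`|b| + 1) / delta) N.
set hb := (h n : 'M[R]_d) *m b in Mn.
have Q1 : 1 <= Q by rewrite lerDl sumr_ge0.
have hb0 : 0 < `|hb|.
  apply: le_lt_trans Mn; rewrite divr_ge0 ?(ltW delta0)// mulr_ge0 ?addr_ge0//.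
  exact: sumr_ge0.
pose u i : 'cV[R]_d := (rat_enum i / `|hb|) *: b.
have uU i : u i \in U by rewrite memvZ.
have u_small i : (i < r)%N -> `|u i| < delta.
  move=> ir; rewrite normrZ normrM normfV normr_id mulrAC ltr_pdivrMr//.
  rewrite ltr_pdivrMr// mulrC in Mn; rewrite mulrC in Mn.
  rewrite mulrC [delta * _]mulrC; apply: le_lt_trans Mn.
  rewrite mulrC ler_pM// ?lerDl//.
  by rewrite /Q (bigD1 (Ordinal ir))//= addrCA lerDl addr_ge0// sumr_ge0.
have mu i : measurable (torus_translate (u i) @^-1` D).
  by rewrite -[X in measurable X]setTI; exact: measurable_torus_translate.
pose B (i : nat) : set (borel_torus x) := D `\` torus_translate (u i) @^-1` D.
have mB i : measurable (B i) by exact: measurableD.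
have DB : D `<=` \big[setU/set0]_(i < r) B i.
  move=> t Dt; rewrite -bigcup_mkord.
  pose gn := (h n * g * SLZ_SLR R (gam n))%g.
  pose v := repr t + w.
  (* As gn Z^d = h_n x, the offset gn^-1 h_n v makes the grid gn (Z^d + p) equal to h_n (x + v). *)
  have [|i ir [z Oz]] := HN n Nn
      (invmx (gn : 'M[R]_d) *m ((h n : 'M[R]_d) *m v)) (`|hb|^-1 *: hb).
    by rewrite normrZ normfV normr_id mulVf// gt_eqF.
  exists i => //; split => //.
  rewrite /= -[t]reprK torus_translate_pi => /avoiding_pi.
  move/(_ (((g * SLZ_SLR R (gam n))%g : 'M[R]_d) *m map_mx intr z)).
  have zx : lattice x (((g * SLZ_SLR R (gam n))%g : 'M[R]_d) *m map_mx intr z).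
    by exists ((gam n : 'M[int]_d) *m z); rewrite //= map_mxM mulmxA.
  move=> /(_ zx); apply; move: Oz.
  (* Since q_i hb / |hb| = h_n u_i, the point reached is h_n applied to u_i + g gamma_n z + v, and
     invariance of [F] removes h_n. *)
  rewrite mulmxDr mulKVmx ?SL_unitmx// -{2}(hF n) /=.
  congr (O (F _)).
  rewrite /u /v !mulmxDr -scalemxAr scalerA !mulmxA addrCA; congr (_ + _).
  by rewrite addrA [_ *: _ + _]addrC.
apply: (le_trans (content_subadditive lambda _ mD DB)) => //.
apply: (@le_trans _ _ (\sum_(i < r) (e / r.+1%:R)%:E)%E).
  by apply: lee_sum => i _; exact: (Hdelta _ (uU i) (u_small i (ltn_ord i))).
rewrite sumEFin lee_fin sumr_const card_ord -[leLHS]mulr_natr mulrAC.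
by rewrite ler_pdivrMr// ler_wpM2l ?ltW// ltr_nat.
Qed.

End AvoidingGrids.

(** * Almost sure density through countably many rational intervals *)

Theorem theorem2p2 (R : realType) (d : nat) (F : 'cV[R]_d -> R)
  (x : Xd R d) (U : {vspace 'cV[R]_d}) (w : 'cV[R]_d)
  (lambda_U : probability (borel_torus x) R) :
  (0 < d)%N ->
  continuous F ->
  nondegenerate_fun F ->
  noncompact_fun F ->
  ~ divergent_orbit (invariance_group F) x ->
  rational_subspace x U ->
  is_haar_subtorus U lambda_U ->
  (exists h : nat -> SL R d,
    [/\ forall n, invariance_group F (h n),
        divergent_seq h,
        exists x0 : Xd R d, SLact (h n) x @[n --> \oo] --> x0 &
        ~ almost_finite h U]) ->
  as_grid_DV F (pushforward lambda_U (torus_translate w)).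
Proof.
move=> _ Fcts Fnd _ _ Urat haar [h [hF _ [x0 hx] hU]].
have hstab n : stabilizer F (h n) by exact: (connected_component_sub (hF n)).
(* The default pair (0, 0) gives the empty interval, which [A] leaves out. *)
pose I (k : nat) : set R :=
  let ab := odflt (0, 0) (unpickle k : option (rat * rat)) in
  [set y | ratr ab.1 < y < ratr ab.2].
(* An interval missing the range of [F] is avoided by every grid, so it must be excluded for the
   union to be null. *)
pose A : set (borel_torus x) :=
  \bigcup_(k in [set k | (I k `&` range F) !=set0]) avoiding F 0 (I k).
have oI k : open (I k).
  have -> : I k = `]ratr (odflt (0, 0) (unpickle k : option (rat * rat))).1,
      ratr (odflt (0, 0) (unpickle k : option (rat * rat))).2[%classic.
    by apply/seteqP; split=> y; rewrite /= in_itv.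
  exact: interval_open.
exists A; split.
- apply: bigcup_measurable => k _.
  by apply: closed_measurable_torus; exact: closed_avoiding.
- rewrite /pushforward /A preimage_bigcup.
  rewrite bigcup_mkcond; apply: measure_negligible.
    apply: bigcupT_measurable => k; case: ifP => // _.
    rewrite avoiding_translate.
    by apply: closed_measurable_torus; exact: closed_avoiding.
  apply: negligible_bigcup => k.
  case: ifPn => [|_]; last exact: negligible_set0.
  rewrite inE /= => Ik; rewrite avoiding_translate; apply/negligibleP.
    by apply: closed_measurable_torus; exact: closed_avoiding.
  exact: (avoiding_null _ _ x0 U w _ h).
- move=> t; apply: contra_notP => At.
  move=> _ [q _ <-] V /nbhs_ballP[e /= e0 eV].
  (* The interval from [a] to [b] contains [F q] and lies in the ball of radius [e] about it, so a
     grid with no value in [V] avoids this interval and belongs to [A]. *)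
  have [a] := @rat_in_itvoo R (F q - e) (F q) ltac:(rewrite ltrBlDr ltrDl//).
  have [b] := @rat_in_itvoo R (F q) (F q + e) ltac:(rewrite ltrDl//).
  rewrite !in_itv/= => /andP[qb be] /andP[ea aq].
  apply: contrapT => nV; apply: At; exists (pickle (a, b)).
    by exists (F q); split; [rewrite /I pickleK/= aq qb|exists q].
  move=> p px; rewrite addr0 /I pickleK/= => /andP[ap pb].
  apply: nV; exists (F (p + repr t)); split.
    by exists (p + repr t) => //; exists p.
  apply: eV; rewrite -ball_normE/= ltr_distlC.
  by rewrite (lt_trans ea ap) (lt_trans pb be).
Qed.
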